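(* Let $d$ be a (pseudo)metric on $\mathcal R(\Omega,\mathcal X)$ and $(\mathbf X^s,\mathbf U^s)$ a stationary pair with $|\ell(\mathbf X^s,\mathbf U^s)|<\infty$. Assume: (1) the optimal control problem is strictly stochastically dissipative at $(\mathbf X^s,\mathbf U^s)$ with respect to $d$, with storage function $\lambda$ and $\alpha\in\mathcal K_\infty$; (2) for every $r>0$, $\lambda$ is uniformly bounded on $\bar B^d_r(\mathbf X^s)$ and $\mathbf X^s$ is cheaply reachable on $\bar B^d_r(\mathbf X^s)$; (3) there exist $\varepsilon>0$ and $\gamma_V:\mathbb R_{\ge0}\times\mathbb R_{\ge0}\to\mathbb R_{\ge0}$ with $\gamma_V(N,\rho)\to0$ as $N\to\infty$ and $\rho\to0$, and with $\gamma_V(\cdot,\rho)$, $\gamma_V(N,\cdot)$ monotone for fixed $\rho$ and $N$, such that $|V_N(j,X_j)-V_N(j,X^s(j))|\le\gamma_V(N,d(X_j,X^s(j)))$ for all $N\in\mathbb N$, $j\in\mathbb N_0$, $X_j\in\bar B^d_\varepsilon(X^s(j))$; (4) $\tilde\ell(j,X^s(j),U^s(j))=0$ for all $j\in\mathbb N_0$; (5) for every $\tilde r>0$ there exist $\tilde\varepsilon\in(0,\tilde r]$ and $\gamma_\lambda,\gamma_{\tilde V}\in\mathcal K_\infty$ such that for all $N\in\mathbb N$, $j\in\mathbb N_0$: $|\lambda(j,X_j)-\lambda(j,X^s(j))|\le\gamma_\lambda(d(X_j,X^s(j)))$ for all $X_j\in\bar B^d_{\tilde\varepsilon}(X^s(j))$,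 and $|\tilde V_N(j,X_j)-\tilde V_N(j,X^s(j))|\le\gamma_{\tilde V}(d(X_j,X^s(j)))$ for all $X_j\in\bar B^d_{\tilde r}(X^s(j))$. Then $\mathbf X^s$ is semi-globally practically asymptotically stable for the MPC closed loop with respect to the optimization horizon $N$, i.e. there exists $\beta\in\mathcal{KL}$ such that for each $\Delta_1>0$ and $\Delta_2>\Delta_1$ there exists $N_\Delta\in\mathbb N$ such that for all $N\ge N_\Delta$, all $j_0,j\in\mathbb N_0$ and all $X_{j_0}\in\bar B^d_{\Delta_2}(X^s(j_0))$, $$d\big(X_{\mu_N}(j;j_0,X_{j_0}),X^s(j+j_0)\big)\le\max\{\beta(d(X_{j_0},X^s(j_0)),j),\Delta_1\}.$$
   Context: Setting. $\mathcal X,\mathcal U,\mathcal W$ are separable Banach spaces, $f:\mathcal X\times\mathcal U\times\mathcal W\to\mathcal X$ is continuous, $(\Omega,\mathcal F,\mathbb P)$ is a probability space, and for $\mathcal Z\in\{\mathcal X,\mathcal U,\mathcal W\}$, $\mathcal R(\Omega,\mathcal Z)$ is the set of measurable maps $(\Omega,\mathcal F)\to(\mathcal Z,\mathcal B(\mathcal Z))$. $W(0),W(1),\dots\in\mathcal R(\Omega,\mathcal W)$ are i.i.d. with distribution $P_W$; throughout, the noise acting at any time is independent of the state and the control at that time. $\mathbb U\subseteq\mathcal U$ is a control constraint set. $g:\mathcal X\times\mathcal U\to\mathbb R$ is lower semicontinuous and bounded from below, and $\ell(X,U):=\mathbb E[g(X,U)]$. Optimal control problem. For $j\in\mathbb N_0$,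 $X_j\in\mathcal R(\Omega,\mathcal X)$ and a control sequence $\mathbf U=(U(0),U(1),\dots)$, $X_{\mathbf U}(0;j,X_j)=X_j$, $X_{\mathbf U}(k+1;j,X_j)=f(X_{\mathbf U}(k;j,X_j),U(k),W(j+k))$. $\mathbb U_{ad}(X):=\{U\in\mathcal R(\Omega,\mathcal U):\sigma(U)\subseteq\sigma(X),\ U(\omega)\in\mathbb U\ \forall\omega\}$; $\mathbb U^N_{ad}(j,X_j)$ ($N\in\mathbb N\cup\{\infty\}$) is the set of control sequences with $U(k)\in\mathbb U_{ad}(X_{\mathbf U}(k;j,X_j))$ for all $0\le k\le N-1$. $J_N(j,X_j,\mathbf U):=\sum_{k=0}^{N-1}\ell(X_{\mathbf U}(k;j,X_j),U(k))$, $V_N(j,X_j):=\inf_{\mathbf U\in\mathbb U^N_{ad}(j,X_j)}J_N(j,X_j,\mathbf U)$, $V_0\equiv0$. Minimizers are denoted $\mathbf U^*_{N}=\mathbf U^*_{N,j,X_j}$; minimizers are assumed to exist whenever they are referred to. MPC feedback: $\mu_N(X_j):=U^*_{N,j,X_j}(0)$, the first element of an optimal control sequence at time $j$ and state $X_j$ (any choice of minimizer). $X_{\mu_N}(\cdot;j_0,X_{j_0})$ is the closed-loop trajectory started at time $j_0$ in $X_{j_0}$, where the first argument counts elapsed steps: $X_{\mu_N}(0;j_0,X_{j_0})=X_{j_0}$ and $X_{\mu_N}(j+1;j_0,X_{j_0})=f(X,\mu_N(X),W(j_0+j))$ with $X=X_{\mu_N}(j;j_0,X_{j_0})$. Stationary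 pair: processes $(\mathbf X^s,\mathbf U^s)$ with $X^s(k+1)=f(X^s(k),U^s(k),W(k))$, $\mathbf U^s\in\mathbb U^\infty_{ad}(0,X^s(0))$, such that the laws of $X^s(k)$, $U^s(k)$ and $(X^s(k),U^s(k))$ do not depend on $k\in\mathbb N_0$; $\ell(\mathbf X^s,\mathbf U^s)$ denotes the constant value $\ell(X^s(k),U^s(k))$. (Pseudo)metrics $d:\mathcal R(\Omega,\mathcal X)^2\to[0,\infty]$ may take the value $\infty$. $\bar B^d_r(X^s(j)):=\{X\in\mathcal R(\Omega,\mathcal X):d(X,X^s(j))\le r\}$, $\bar B^d_r(\mathbf X^s):=\{(j,X_j):j\in\mathbb N_0,\ X_j\in\bar B^d_r(X^s(j))\}$. Comparison functions on $[0,\infty)$: $\mathcal K$: continuous, strictly increasing, zero at $0$; $\mathcal K_\infty$: unbounded functions in $\mathcal K$; $\mathcal L$: continuous, strictly decreasing to $0$; $\mathcal{KL}$: continuous $\beta:[0,\infty)^2\to[0,\infty)$ with $\beta(\cdot,t)\in\mathcal K$ for all $t$ and $\beta(s,\cdot)\in\mathcal L$ for all $s$. Strict stochastic dissipativity at $(\mathbf X^s,\mathbf U^s)$ w.r.t. $d$: there are a storage function $\lambda:\mathbb N_0\times\mathcal R(\Omega,\mathcal X)\to\mathbb R$, uniformly bounded from below, and $\alpha\in\mathcal K_\infty$ with $$\tilde\ell(j,X,U):=\ell(X,U)-\ell(\mathbf X^s,\mathbf U^s)+\lambda(j,X)-\lambda(j+1,f(X,U,W(j)))\ge\alpha(d(X,X^s(j)))$$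 for all $j\in\mathbb N_0$, $X\in\mathcal R(\Omega,\mathcal X)$, $U\in\mathbb U_{ad}(X)$. Cheap reachability on $\bar B^d_r(\mathbf X^s)$: there is $C_V>0$ with $V_N(j,X_j)-N\ell(\mathbf X^s,\mathbf U^s)\le C_V$ for all $(j,X_j)\in\bar B^d_r(\mathbf X^s)$, $N\in\mathbb N$. Modified problem: $\tilde J_N(j,X_j,\mathbf U):=\sum_{k=0}^{N-1}\tilde\ell(j+k,X_{\mathbf U}(k;j,X_j),U(k))$, $\tilde V_N(j,X_j):=\inf_{\mathbf U\in\mathbb U^N_{ad}(j,X_j)}\tilde J_N(j,X_j,\mathbf U)$.
   Formalization: The class KL is taken with β(s,·) in L for all s > 0 only; as written, for all s including 0, it would be empty, because β(·,t) in K forces β(0,t) = 0 for every t, which is not strictly decreasing. *)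

(* Defs.v *)
From HB Require Import structures.
From mathcomp Require Export all_boot all_order all_algebra.
From mathcomp Require Export finmap.
From mathcomp Require Export all_classical all_reals all_analysis.

Set Implicit Arguments.
Unset Strict Implicit.
Unset Printing Implicit Defensive.

Export Order.TTheory GRing.Theory Num.Theory.
Export numFieldNormedType.Exports.

#[global] Open Scope classical_set_scope.
#[global] Open Scope ring_scope.

Definition separable (T : topologicalType) :=
  exists2 D : set T, countable D & dense D.

(* The library has no such instance for products; normed modules are pointed. *)
HB.instance Definition _ (Y Z : ptopologicalType) :=
  Topological.on (Y * Z)%type.

(* [Z] with its Borel sigma-algebra. *)
Notation borelType Z := (g_sigma_algebraType (@open Z)).

(** * Comparison functions

    Functions on [0, oo[ are represented by functions on [R], of which only the
    values at nonnegative arguments matter. *)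

Section comparison.
Variable R : realType.
Implicit Types (a : R -> R) (b : R -> R -> R).

Let nonneg : set R := [set x | 0 <= x].

Definition classK a :=
  [/\ {within nonneg, continuous a},
      (forall x y, 0 <= x -> x < y -> a x < a y) & a 0 = 0].

Definition classKoo a := classK a /\ (forall M, exists2 x, 0 <= x & M < a x).

Definition classL a :=
  [/\ {within nonneg, continuous a},
      (forall x y, 0 <= x -> x < y -> a y < a x) & a x @[x --> +oo] --> 0].

(* [b s] is required to be in class L for [s > 0] only: [b 0] is identically 0
   because each [b ^~ t] is in class K, so it is never strictly decreasing. *)
Definition classKL b :=
  [/\ {within [set z : R * R | 0 <= z.1 /\ 0 <= z.2],
        continuous (fun z => b z.1 z.2)},
      (forall t, 0 <= t -> classK (b ^~ t)) &
      (forall s, 0 < s -> classL (b s))].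

Definition monotone_nonneg a :=
  (forall x y, 0 <= x -> x <= y -> a x <= a y) \/
  (forall x y, 0 <= x -> x <= y -> a y <= a x).

(* g(n, r) -> 0 jointly as n -> oo and r -> 0 in [0, oo[ *)
Definition vanishing (g : R -> R -> R) :=
  (fun z => g z.1 z.2) @ filter_prod (pinfty_nbhs R) (within nonneg (nbhs 0))
    --> 0.

End comparison.

(** * Random variables *)

Section random_variables.
Context d (Omega : measurableType d) (R : realType) (P : probability Omega R).

Definition rv (Z : ptopologicalType) (X : Omega -> Z) :=
  measurable_fun [set: Omega] (X : Omega -> borelType Z).

Definition sigma_rv (Z : ptopologicalType) (X : Omega -> Z) :
  set (set Omega) :=
  preimage_set_system setT X (@measurable _ (borelType Z)).

Definition same_law (Z : ptopologicalType) (X Y : Omega -> Z) :=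
  forall B : set (borelType Z), measurable B -> P (X @^-1` B) = P (Y @^-1` B).

Definition independent (Y Z : ptopologicalType) (X1 : Omega -> Y)
    (X2 : Omega -> Z) :=
  forall (A : set (borelType Y)) (B : set (borelType Z)),
    measurable A -> measurable B ->
    P (X1 @^-1` A `&` X2 @^-1` B) = (P (X1 @^-1` A) * P (X2 @^-1` B))%E.

Definition mutually_independent (Z : ptopologicalType)
    (W : nat -> Omega -> Z) :=
  forall (J : {fset nat}) (B : nat -> set (borelType Z)),
    (forall i, measurable (B i)) ->
    P (\bigcap_(i in [set` J]) W i @^-1` B i) =
      (\prod_(i <- J) P (W i @^-1` B i))%E.

Definition iid (Z : ptopologicalType) (W : nat -> Omega -> Z)
    (PW : probability (borelType Z) R) :=
  [/\ forall k, rv (W k), mutually_independent W &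
      forall k (B : set (borelType Z)), measurable B ->
        P (W k @^-1` B) = PW B].

(* A metric is the special case where the distance 0 forces equality. *)
Definition pseudometric (Z : ptopologicalType)
    (dist : (Omega -> Z) -> (Omega -> Z) -> \bar R) :=
  [/\ forall X Y, rv X -> rv Y -> (0 <= dist X Y)%E,
      forall X, rv X -> dist X X = 0%E,
      forall X Y, rv X -> rv Y -> dist X Y = dist Y X &
      forall X Y Z, rv X -> rv Y -> rv Z ->
        (dist X Z <= dist X Y + dist Y Z)%E].

End random_variables.

(** * The stochastic optimal control problem *)

Record ocp d (Omega : measurableType d) (R : realType)
    (X U W : completeNormedModType R) := Ocp {
  dyn : X * U * W -> X;
  noise : nat -> Omega -> W;
  controls : set U;
  stage_cost : X * U -> R
}.

Section ocp.
Context d (Omega : measurableType d) (R : realType) (P : probability Omega R)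
  (Xsp Usp Wsp : completeNormedModType R) (S : ocp Omega Xsp Usp Wsp).

Local Notation rX := (Omega -> Xsp).
Local Notation rU := (Omega -> Usp).

Definition next (j : nat) (X : rX) (U : rU) : rX :=
  fun w => dyn S (X w, U w, noise S j w).

(* traj j X U k is the state k steps after time j; the noise acting in step k
   is the one with the absolute time index j + k. *)
Fixpoint traj (j : nat) (X : rX) (U : nat -> rU) (k : nat) : rX :=
  if k is k'.+1 then next (j + k')%N (traj j X U k') (U k') else X.

Definition Uad (X : rX) : set rU :=
  [set U | [/\ rv U, sigma_rv U `<=` sigma_rv X &
               forall w, controls S (U w)]].

Definition UadN (N j : nat) (X : rX) : set (nat -> rU) :=
  [set U | forall k, (k < N)%N -> Uad (traj j X U k) (U k)].

Definition Uadoo (j : nat) (X : rX) : set (nat -> rU) :=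
  [set U | forall k, Uad (traj j X U k) (U k)].

(* The random states which may occur at time j under the convention that the
   noise acting at any time is independent of the state and the control at that
   time: this has to hold along every admissible trajectory starting in X at
   time j. A random variable that is independent of the whole family of noises
   from time j on, in particular a constant, is such a state. *)
Definition state_at (j : nat) : set rX :=
  [set X | rv X /\ forall U, Uadoo j X U -> forall k,
    independent P (fun w => (traj j X U k w, U k w)) (noise S (j + k)%N)].

Definition ell (X : rX) (U : rU) : \bar R :=
  'E_P[fun w => stage_cost S (X w, U w)].

Definition J (N j : nat) (X : rX) (U : nat -> rU) : \bar R :=
  (\sum_(k < N) ell (traj j X U k) (U k))%E.

Definition V (N j : nat) (X : rX) : \bar R :=
  ereal_inf [set J N j X U | U in UadN N j X].

Definition minimizer (N j : nat) (X : rX) (U : nat -> rU) :=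
  UadN N j X U /\ J N j X U = V N j X.

Definition mpc_feedback (mu : nat -> nat -> rX -> rU) :=
  forall N j X, (0 < N)%N -> state_at j X ->
    (exists U, minimizer N j X U) ->
    exists2 U, minimizer N j X U & mu N j X = U 0%N.

(* j0 is the absolute initial time, k the number of elapsed steps. *)
Fixpoint closed_loop (mu : nat -> rX -> rU) (j0 : nat) (X : rX) (k : nat) :
  rX :=
  if k is k'.+1 then
    let Y := closed_loop mu j0 X k' in next (j0 + k')%N Y (mu (j0 + k')%N Y)
  else X.

Definition stationary_pair (Xs : nat -> rX) (Us : nat -> rU) :=
  [/\ state_at 0%N (Xs 0%N),
      forall k, Xs k.+1 = next k (Xs k) (Us k),
      Uadoo 0%N (Xs 0%N) Us &
      forall k, [/\ same_law P (Xs k) (Xs 0%N), same_law P (Us k) (Us 0%N) &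
        same_law P (fun w => (Xs k w, Us k w))
                   (fun w => (Xs 0%N w, Us 0%N w))]].

(* ell (Xs k) (Us k) does not depend on k for a stationary pair. *)
Definition stationary_cost (Xs : nat -> rX) (Us : nat -> rU) : \bar R :=
  ell (Xs 0%N) (Us 0%N).

Definition mod_ell (lam : nat -> rX -> R) (ls : \bar R) (j : nat) (X : rX)
    (U : rU) : \bar R :=
  (ell X U - ls + (lam j X)%:E - (lam j.+1 (next j X U))%:E)%E.

Definition mod_J (lam : nat -> rX -> R) (ls : \bar R) (N j : nat) (X : rX)
    (U : nat -> rU) : \bar R :=
  (\sum_(k < N) mod_ell lam ls (j + k)%N (traj j X U k) (U k))%E.

Definition mod_V (lam : nat -> rX -> R) (ls : \bar R) (N j : nat) (X : rX) :
  \bar R :=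
  ereal_inf [set mod_J lam ls N j X U | U in UadN N j X].

Variable dist : rX -> rX -> \bar R.

(* The section at time j of the closed ball around the process Xs. *)
Definition cball (Xs : nat -> rX) (r : R) (j : nat) : set rX :=
  [set X | state_at j X /\ (dist X (Xs j) <= r%:E)%E].

(* [er_map alpha] extends alpha by alpha(+oo) = +oo. *)
Definition strictly_dissipative (Xs : nat -> rX) (Us : nat -> rU)
    (lam : nat -> rX -> R) (alpha : R -> R) :=
  [/\ exists m, forall j X, rv X -> m <= lam j X,
      classKoo alpha &
      forall j X U, state_at j X -> Uad X U ->
        (er_map alpha (dist X (Xs j)) <=
         mod_ell lam (stationary_cost Xs Us) j X U)%E].

Definition cheaply_reachable (Xs : nat -> rX) (Us : nat -> rU) (r : R) :=
  exists2 C : R, 0 < C & forall N j X, (0 < N)%N -> cball Xs r j X ->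
    (V N j X - N%:R%:E * stationary_cost Xs Us <= C%:E)%E.

Definition bounded_on_cball (Xs : nat -> rX) (lam : nat -> rX -> R) (r : R) :=
  exists C : R, forall j X, cball Xs r j X -> `|lam j X| <= C.

End ocp.

(* Main.v *)
Require Import Defs.
From mathcomp Require Import lra ring.

Set Implicit Arguments.
Unset Strict Implicit.
Unset Printing Implicit Defensive.

(** The optimal value [mod_V N] of the modified problem is a practical
    Lyapunov function of the closed loop with horizon [N]. It lies between
    [alpha] of the distance to the stationary process, since modified stage
    costs are bounded below by [alpha] of the distance, and [g] of the
    distance for one function [g] of class K, since it is continuous at the
    stationary process, where it vanishes ([alpha_dist_le_mod_V],
    [mod_V_majorant]).

    The difficulty is that the feedback minimizes the original cost and not
    the modified one. The two costs of a trajectory differ only by the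
    values of the storage function at its end points ([mod_J_J]), and the
    end points are made irrelevant by the turnpike property: a control of
    bounded modified cost keeps the state close to the stationary process at
    all but a bounded number of times, so that for a long horizon an optimal
    control of the original problem and a nearly optimal one of the modified
    problem are both close to it at a common early time ([common_turnpike]).
    At that time the costs to go and the storage functions nearly agree, so
    the original optimal control is nearly optimal for the modified problem
    too, and [mod_V N] decreases along the closed loop by the modified stage
    cost up to an arbitrarily small error ([nearly_decreasing],
    [lyapunov_decrease]), uniformly on each ball.

    The rest concerns sequences of reals. While the Lyapunov function
    exceeds a threshold given by the target radius, it decreases in each step
    by at least half of [alpha] of the distance. Hence the sum of these
    values up to time [k] is at most twice [g s], [s] being the initial
    distance, and one of them is at most [2 g(s) / (1 + k)]. By monotonicity
    this gives the bound of class KL with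
    [beta s t = b (g (b (2 g(s) / (1 + t))))],
    [b] the inverse of [alpha] ([practical_decay]); it depends on [alpha]
    and [g] only, hence neither on the radii nor on the horizon.

    Probability enters only in showing that successors of admissible states
    are admissible states, where separability makes the joint map of the
    state, the control and the noise measurable ([state_at_next],
    [rv_pair]). *)

(** * Comparison functions *)

Section global_comparison.
Variable R : realType.
Implicit Types (a f g : R -> R).

(** Class K functions are given on the nonnegative half-line only. Replacing
    them by increasing continuous functions on the whole line turns relative
    continuity into continuity and makes composition unconditional. *)
Definition globalK f :=
  [/\ continuous f, {homo f : x y / x < y} & f 0 = 0].

Lemma within_comp (A : set R) (T : topologicalType) (a : R -> R) (h : T -> R) :
  {within A, continuous a} -> continuous h -> (forall x, A (h x)) ->
  continuous (a \o h).
Proof.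
move=> /subspace_continuousP ca ch hA x.
apply: (@cvg_comp _ _ _ h a (nbhs x) (within A (nbhs (h x)))); last exact: ca.
move=> B /= hB; have H := ch x _ hB.
by apply: filterS (H : nbhs x (h @^-1` [set y | A y -> B y])) => y; apply.
Qed.

Lemma continuous_max0 : continuous (fun x : R => Num.max x 0).
Proof. by move=> x; apply: continuous_max; [exact: cvg_id|exact: cvg_cst]. Qed.

(** Gluing the identity to the left of 0 keeps the function increasing and, for
    unbounded [a], makes it onto, which the inversion below relies on. *)
Lemma classK_extension a : classK a ->
  exists2 f, globalK f & (forall x, 0 <= x -> f x = a x) /\
                         (forall x, x <= 0 -> f x = x).
Proof.
move=> [ca ia a0]; exists (fun x => a (Num.max x 0) + Num.min x 0); last split.
- split; last by rewrite maxxx minxx a0 addr0.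
  + move=> x; apply: cvgD.
      have max_ge0 y : [set z : R | 0 <= z] (Num.max y 0).
        by rewrite /= le_max lexx orbT.
      exact: (within_comp ca continuous_max0 max_ge0).
    by apply: continuous_min; [exact: cvg_id|exact: cvg_cst].
  + move=> x y xy.
    have [x0|x0] := leP 0 x; have [y0|y0] := leP 0 y.
    - by rewrite !addr0 ia.
    - by exfalso; lra.
    - rewrite a0 add0r addr0 (lt_le_trans x0)//.
      move: y0; rewrite le_eqVlt => /orP[/eqP<-|y0]; first by rewrite a0.
      by rewrite -a0 ltW// ia.
    - by rewrite a0 !add0r.
- by move=> x x0; rewrite max_l// min_r// addr0.
- by move=> x x0; rewrite max_r// min_l// a0 add0r.
Qed.

Lemma globalK_ge0 f x : globalK f -> 0 <= x -> 0 <= f x.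
Proof.
by move=> [_ f_inc f0] x0; rewrite -f0; exact: ltW_homo.
Qed.

Lemma globalK_comp f g : globalK f -> globalK g -> globalK (f \o g).
Proof.
move=> [cf fi f0] [cg gi g0]; split; last by rewrite /= g0.
- by move=> x; apply: continuous_comp; [exact: cg|exact: cf].
- by move=> x y xy; apply/fi/gi.
Qed.

(** The inverse of [a], in the only form in which it is applied: bounds on [a x]
    become bounds on [x]. *)
Lemma classKoo_inverse a : classKoo a ->
  exists2 b, globalK b & forall x y, 0 <= x -> a x <= y -> x <= b y.
Proof.
move=> [aK a_unb].
have [f [cf f_inc f0] [fa fid]] := classK_extension aK.
have f_leW : {mono f : x y / x <= y} by apply/le_mono.
have f_inj : injective f by apply/inc_inj.
have f_surj y : exists x, f x = y.
  have [y0|y0] := leP y 0; first by exists y; exact: fid.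
  have [z z0 yz] := a_unb y.
  have [|c _ <-] := @IVT R f 0 z y z0 (continuous_subspaceT cf);
    last by exists c.
  by rewrite f0 fa// ge_min le_max (ltW y0) (ltW yz) orbT.
have [b bK] := choice f_surj.
have fK : cancel f b by move=> x; apply: f_inj; rewrite bK.
have b_le : {mono b : x y / x <= y} by move=> x y; rewrite -f_leW !bK.
exists b.
  split.
  - move=> y; rewrite -(bK y).
    have : \forall z \near f (b y), {for z, continuous b}.
      by apply: near_can_continuous; near=> x; [exact: fK|exact: cf].
    exact: nbhs_singleton.
  - by move=> x y; rewrite (leW_mono b_le).
  - by rewrite -[in LHS]f0 fK.
by move=> x y x0; rewrite -fa// -{2}(fK x) b_le.
Unshelve. all: end_near. Qed.

(** Only [c n] with [x <= n.+1] is available at [x], and the [c n] are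
    unrelated, so a function of class K above all of them has to be glued
    together. Near 0 it starts as [c 0]; beyond 1 only the values at the
    right end points matter, as the [c n] are monotone, and these are added
    as ramps, locally finite in number. The ramp starting at [k] is at least
    [c k.+1 k.+2%:R], its slope, from [k.+1] on. *)
Lemma classK_majorant (c : nat -> R -> R) : (forall n, classK (c n)) ->
  exists2 g, globalK g &
    forall x, 0 <= x -> exists2 n, x <= n.+1%:R & c n x <= g x.
Proof.
move=> cK.
have [f fK [fc _]] := classK_extension (cK 0%N); have [cf f_inc f0] := fK.
have c_le n x y : 0 <= x -> x <= y -> c n x <= c n y.
  move=> x0; have [_ ci _] := cK n.
  by rewrite le_eqVlt => /orP[/eqP->//|xy]; exact/ltW/ci.
have c_ge0 n x : 0 <= x -> 0 <= c n x.
  by move=> x0; have [_ _ <-] := cK n; rewrite c_le.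
pose t k x := c k.+1 k.+2%:R * Num.max (x - k%:R) 0.
have t_ge0 k x : 0 <= t k x.
  by rewrite mulr_ge0 ?c_ge0// le_max lexx orbT.
pose h M x := f x + \sum_(0 <= k < M) t k x.
pose g x := h (Num.truncn x).+1 x.
(* The terms beyond x vanish, so that g is locally a fixed finite sum. *)
have gE M x : x <= M%:R -> g x = h M x.
  move=> xM.
  suff E m n : (m <= n)%N -> x <= m%:R -> h n x = h m x.
    have [le|/ltnW le] := leqP M (Num.truncn x).+1; first exact: E.
    by rewrite /g -(E _ _ le)// ltW// truncnS_gt.
  move=> mn xm; rewrite /h (big_cat_nat (leq0n m) mn)/=.
  suff -> : \sum_(m <= k < n) t k x = 0 by rewrite addr0.
  rewrite big_nat big1// => k /andP[mk _].
  rewrite /t max_r ?mulr0// subr_le0.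
  by rewrite (le_trans xm)// ler_nat.
have h_cont M : continuous (h M).
  move=> x; apply: cvgD; first exact: cf.
  have cD : continuous (fun z : R * R => z.1 + z.2) by exact: add_continuous.
  apply: (@cvg_big R nat +%R 0 xpredT cD) => k _.
  apply: cvgM; first exact: cvg_cst.
  apply: (@continuous_comp _ _ _ (fun x : R => x - k%:R)
    (fun x => Num.max x 0));
    last exact: continuous_max0.
  by apply: cvgB; [exact: cvg_id|exact: cvg_cst].
have h_inc M : {homo h M : x y / x < y}.
  move=> x y xy; rewrite /h ltr_leD ?f_inc//; apply: ler_sum => k _.
  by rewrite ler_wpM2l ?c_ge0// ge_max !le_max lexx orbT lerB// ltW.
exists g.
  split.
  - move=> x; pose M := (Num.truncn x).+1.
    have xM : x < M%:R by exact: truncnS_gt.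
    rewrite /continuous_at (gE M) ?ltW//.
    apply: cvg_trans (h_cont M x); apply: near_eq_cvg.
    by near=> y; rewrite (gE M)// ltW//; near: y; exact: lt_nbhsl.
  - move=> x y xy; pose M := (Num.truncn y).+1.
    have yM : y <= M%:R by rewrite ltW// truncnS_gt.
    by rewrite !(gE M) ?(le_trans (ltW xy))// h_inc.
  - by rewrite (gE 0%N)// /h big_nil f0 addr0.
move=> x x0; have [x1|x1] := leP x 1.
  by exists 0%N => //; rewrite /g/h fc// lerDl sumr_ge0.
have xn := truncn_itv x0; have /andP[nx xn1] := xn.
have : (0 < Num.truncn x)%N by rewrite truncn_gt0 ltW.
case E : (Num.truncn x) => [//|m] _; rewrite E in nx xn1.
exists m.+1; first exact: ltW.
rewrite /g E /h; apply: (@le_trans _ _ (t m x)).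
  have := @c_le m.+1 x m.+2%:R x0 (ltW xn1) => /le_trans; apply.
  have mx : 1 <= x - m%:R by move: nx; rewrite -natr1; lra.
  by rewrite /t ler_peMr ?c_ge0// le_max mx.
rewrite big_nat_recr//= big_nat_recr//=.
have S0 : 0 <= \sum_(0 <= k < m) t k x by rewrite sumr_ge0.
have fx0 := globalK_ge0 fK x0.
by have := t_ge0 m.+1 x; lra.
Unshelve. all: end_near. Qed.

(** The form of the bound in [practical_decay]: decay like the inverse of time
    inside a function of class K. *)
Lemma classKL_harmonic (F g : R -> R) : globalK F -> globalK g ->
  classKL (fun s t => F (g s / (1 + t))).
Proof.
move=> FK gK; have [cF Fi F0] := FK; have [cg gi g0] := gK.
have invt (t : R) : 0 <= t -> 0 < (1 + t)^-1 by move=> ?; rewrite invr_gt0; lra.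
split.
- apply/subspace_continuousP => /= z [z1 z2].
  pose G (z : R * R) := F (g z.1 / (1 + Num.max z.2 0)).
  rewrite [X in _ --> X](_ : _ = G z); last by rewrite /G max_l.
  suff cG : {for z, continuous G}.
    move=> B /= BG; apply: (@filterS _ (nbhs z) _ (G @^-1` B)); last exact: cG.
    by move=> y By [y1 y2]; move: By; rewrite /G /= max_l.
  rewrite /G; apply: (@continuous_comp _ _ _
    (fun z : R * R => g z.1 / (1 + Num.max z.2 0)) F); last exact: cF.
  apply: cvgM.
    by apply: (@continuous_comp _ _ _ fst g); [exact: cvg_fst|exact: cg].
  apply: cvgV; first by rewrite /= max_l//; lra.
  apply: cvgD; first exact: cvg_cst.
  have max_z2 : Num.max x 0 @[x --> z.2] --> Num.max z.2 0.
    exact: continuous_max0.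
  by apply: (cvg_comp snd _ _ max_z2); exact: cvg_snd.
- move=> t /invt t0; split.
  + apply: continuous_subspaceT => x.
    apply: (@continuous_comp _ _ _ (fun x => g x / (1 + t)) F); last exact: cF.
    by apply: cvgM; [exact: cg|exact: cvg_cst].
  + by move=> x y _ xy; apply: Fi; rewrite ltr_pM2r// gi.
  + by rewrite g0 mul0r F0.
- move=> s s0; have gs0 : 0 < g s by rewrite -g0 gi.
  split.
  + apply/subspace_continuousP => /= t t0.
    apply: cvg_within_filter.
    have cFt : F x @[x --> g s / (1 + t)] --> F (g s / (1 + t)) by exact: cF.
    apply: (cvg_comp (fun t => g s / (1 + t)) _ _ cFt).
    apply: cvgM; first exact: cvg_cst. apply: cvgV; first by lra.
    by apply: cvgD; [exact: cvg_cst|exact: cvg_id].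
  + move=> x y x0 xy; apply: Fi; rewrite ltr_pM2l// ltf_pV2 ?posrE; lra.
  + rewrite -F0; apply: cvg_comp; last exact: cF.
    rewrite -(mulr0 (g s)); apply: cvgM; first exact: cvg_cst.
    apply/gtr0_cvgV0; first by near=> x; have : 0 < x by []; lra.
    apply/cvgryPge => A; near=> x.
    suff : A <= x by lra.
    by near: x; apply: nbhs_pinfty_ge; exact: num_real.
Unshelve. all: end_near. Qed.

End global_comparison.

(** * Borel measurability in separable spaces *)

Section countable_bases.

(** A countable base of the topology, enumerated so that open sets are countable
    unions of base sets over natural indices. *)
Definition open_base (T : topologicalType) (b : nat -> set T) :=
  (forall n, open (b n)) /\
  (forall x A, nbhs x A -> exists2 n, b n x & b n `<=` A).

Definition reindex_pairs (T : Type) (b : nat * nat -> set T) (n : nat) :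
    set T :=
  oapp b set0 (choice.unpickle n).

Lemma open_base_pairs (T : topologicalType) (b : nat * nat -> set T) :
  (forall p, open (b p)) ->
  (forall x A, nbhs x A -> exists2 p, b p x & b p `<=` A) ->
  open_base (reindex_pairs b).
Proof.
move=> b_open b_base; split=> [n|x A /b_base[p bx bA]].
  rewrite /reindex_pairs; case: choice.unpickle => [p|]; first exact: b_open.
  exact: open0.
by exists (choice.pickle p); rewrite /reindex_pairs choice.pickleK.
Qed.

Lemma separable_open_base (R : realType) (V : normedModType R) :
  separable V -> exists b : nat -> set V, open_base b.
Proof.
move=> [D /pfcard_geP[->|[f]] dD].
  have [||x []//] := dD setT; last exact: openT.
  by exists 0.
exists (reindex_pairs (fun p => ball (f p.1) (p.2.+1%:R^-1 : R))).
apply: open_base_pairs => [p|x A]; first exact: ball_open.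
move=> /nbhs_ballP[/= e e0 eA].
have [j] : exists j, (j.+1%:R^-1 : R) < e / 2.
  exists (Num.truncn (e / 2)^-1).
  by rewrite invf_plt ?posrE ?divr_gt0//; exact: truncnS_gt.
move=> je; have j0 : (0 : R) < j.+1%:R^-1 by [].
have [] := dD (ball x j.+1%:R^-1).
- by exists x; exact: ballxx.
- exact: ball_open.
move=> z [xz] /(@surj _ _ _ _ f)[i _ fiz].
exists (i, j); rewrite /= fiz; first exact: ball_sym.
move=> y zy; apply: eA; apply: (@ball_split _ _ z).
  by apply: le_ball xz; exact: ltW.
by apply: le_ball zy; exact: ltW.
Qed.

Lemma open_base_prod (T1 T2 : topologicalType) (b1 : nat -> set T1)
    (b2 : nat -> set T2) : open_base b1 -> open_base b2 ->
  open_base (reindex_pairs (fun p => b1 p.1 `*` b2 p.2)).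
Proof.
move=> [open1 base1] [open2 base2]; apply: open_base_pairs => [p|[x1 x2] A].
  rewrite openE => -[y1 y2] [/= y1b y2b]; exists (b1 p.1, b2 p.2) => //=.
  by split; apply: open_nbhs_nbhs.
move=> [[A1 A2] /= [n1 n2] A12].
have [i bi biA] := base1 _ _ n1; have [j bj bjA] := base2 _ _ n2.
by exists (i, j) => [//|[y1 y2] [/biA y1A /bjA y2A]]; exact: A12.
Qed.

Context dd (Omega : measurableType dd).

Lemma rv_open (Z : ptopologicalType) (X : Omega -> Z) :
  (forall O, open O -> measurable (X @^-1` O)) -> rv X.
Proof.
move=> H; apply: (@measurability _ _ _ (borelType Z) _ _ (@open Z)) => //.
by move=> _ [G oG <-]; rewrite setTI; exact: H.
Qed.

Lemma rv_preimage_open (Z : ptopologicalType) (X : Omega -> Z) (O : set Z) :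
  rv X -> open O -> measurable (X @^-1` O).
Proof.
move=> mX oO; rewrite -[X in measurable X]setTI; apply: mX => //.
exact: sub_sigma_algebra.
Qed.

Lemma rv_comp (Y Z : ptopologicalType) (f : Y -> Z) (X : Omega -> Y) :
  continuous f -> rv X -> rv (f \o X).
Proof.
move=> /continuousP cf mX; apply: rv_open => O oO.
by rewrite comp_preimage; apply: rv_preimage_open => //; exact: cf.
Qed.

(** Without countable bases this can fail: the Borel sets of a product need not be
    generated by rectangles. *)
Lemma rv_pair (Y Z : ptopologicalType) (bY : nat -> set Y) (bZ : nat -> set Z)
    (X1 : Omega -> Y) (X2 : Omega -> Z) :
  open_base bY -> open_base bZ -> rv X1 -> rv X2 ->
  rv (fun w => (X1 w, X2 w)).
Proof.
move=> baseY baseZ m1 m2; apply: rv_open => O oO.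
have [bo base] := open_base_prod baseY baseZ.
pose b := reindex_pairs (fun p => bY p.1 `*` bZ p.2).
have -> : (fun w => (X1 w, X2 w)) @^-1` O =
    \bigcup_(n in [set n | b n `<=` O]) ((fun w => (X1 w, X2 w)) @^-1` b n).
  apply/seteqP; split=> [w Ow|w [n bO]]; last exact: bO.
  by have [n bn bO] := base _ _ (open_nbhs_nbhs (conj oO Ow)); exists n.
apply: bigcup_measurable => n _; rewrite /b /reindex_pairs.
case: choice.unpickle => [[i j]|] /=; last by rewrite preimage_set0.
apply: (@measurableI _ _ (X1 @^-1` bY i) (X2 @^-1` bZ j)).
  by apply: rv_preimage_open => //; have [] := baseY.
by apply: rv_preimage_open => //; have [] := baseZ.
Qed.

End countable_bases.

(** * Concatenation of controls and dynamic programming *)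

Section dynamic_programming.
Context dd (Omega : measurableType dd) (R : realType) (P : probability Omega R)
  (Xsp Usp Wsp : completeNormedModType R) (S : ocp Omega Xsp Usp Wsp).

Local Notation rX := (Omega -> Xsp).
Local Notation rU := (Omega -> Usp).
Implicit Types (j k m N : nat) (X : rX) (U : nat -> rU).

Definition shift (T : Type) (U : nat -> T) k : nat -> T := fun i => U (k + i)%N.

Definition splice (T : Type) (U : nat -> T) k (U' : nat -> T) : nat -> T :=
  fun i => if (i < k)%N then U i else U' (i - k)%N.

Lemma shift_splice (T : Type) (U U' : nat -> T) k :
  shift (splice U k U') k = U'.
Proof.
by apply/funext => i; rewrite /shift /splice ltnNge leq_addr addKn.
Qed.

Lemma traj_eq j X U U' k : (forall i, (i < k)%N -> U i = U' i) ->
  traj S j X U k = traj S j X U' k.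
Proof.
by elim: k => //= k IH UU'; rewrite IH ?UU'// => i ik; rewrite UU'// ltnW.
Qed.

Lemma traj_splice j X U k U' i : (i <= k)%N ->
  traj S j X (splice U k U') i = traj S j X U i.
Proof.
move=> ik; apply: traj_eq => i' i'i.
by rewrite /splice (leq_trans i'i).
Qed.

Lemma traj_shift j X U k m :
  traj S j X U (k + m) = traj S (j + k) (traj S j X U k) (shift U k) m.
Proof.
by elim: m => [|m IH]; [rewrite addn0|rewrite addnS /= IH addnA].
Qed.

Lemma UadN_le j X U k N : (k <= N)%N -> UadN S N j X U -> UadN S k j X U.
Proof. by move=> kN UN i ik; apply: UN; exact: leq_trans kN. Qed.

Lemma UadN_shift j X U k m : UadN S (k + m) j X U ->
  UadN S m (j + k) (traj S j X U k) (shift U k).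
Proof.
by move=> Ukm i im; rewrite -traj_shift; apply: Ukm; rewrite ltn_add2l.
Qed.

Lemma UadN_splice j X U k m U' : UadN S k j X U ->
  UadN S m (j + k) (traj S j X U k) U' -> UadN S (k + m) j X (splice U k U').
Proof.
move=> Uk U'm i ikm; have [ik|ki] := ltnP i k.
  by rewrite traj_splice ?(ltnW ik)// /splice ik; exact: Uk.
have -> : i = (k + (i - k))%N by rewrite subnKC.
rewrite traj_shift shift_splice traj_splice//.
rewrite -[splice _ _ _ _]/(shift _ _ _) shift_splice.
by apply: U'm; rewrite ltn_subLR.
Qed.

(** The original and the modified problem differ only in the stage cost [L], so
    that [J], [V] and [mod_J], [mod_V] are instances by unfolding, and dynamic
    programming is done once. *)
Definition total_cost (L : nat -> rX -> rU -> \bar R) N j X U : \bar R :=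
  (\sum_(k < N) L (j + k)%N (traj S j X U k) (U k))%E.

Definition optimal_value L N j X : \bar R :=
  ereal_inf [set total_cost L N j X U | U in UadN S N j X].

Lemma total_cost_cat L k m j X U :
  total_cost L (k + m) j X U =
  (total_cost L k j X U +
   total_cost L m (j + k) (traj S j X U k) (shift U k))%E.
Proof.
rewrite /total_cost big_split_ord /=; congr (_ + _)%E.
by apply: eq_bigr => i _; rewrite traj_shift addnA.
Qed.

Lemma total_cost_splice L k m j X U U' :
  total_cost L (k + m) j X (splice U k U') =
  (total_cost L k j X U + total_cost L m (j + k) (traj S j X U k) U')%E.
Proof.
rewrite total_cost_cat shift_splice traj_splice//; congr (_ + _)%E.
apply: eq_bigr => i _; rewrite traj_splice ?(ltnW (ltn_ord i))//.
by rewrite /splice ltn_ord.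
Qed.

Lemma optimal_value_le L N j X U : UadN S N j X U ->
  (optimal_value L N j X <= total_cost L N j X U)%E.
Proof. by move=> UN; apply: ereal_inf_lbound; exists U. Qed.

Lemma optimal_value_cat_le L k m j X U : UadN S k j X U ->
  total_cost L k j X U \is a fin_num ->
  (optimal_value L (k + m) j X <=
   total_cost L k j X U + optimal_value L m (j + k) (traj S j X U k))%E.
Proof.
move=> Uk cfin; rewrite addeC -leeBlDr//; apply/ereal_infP => _ [U' U'm <-].
rewrite leeBlDr// addeC -total_cost_splice.
exact/optimal_value_le/UadN_splice.
Qed.

Lemma total_cost_ge0 L N j X U :
  (forall k, (k < N)%N -> (0 <= L (j + k)%N (traj S j X U k) (U k))%E) ->
  (0 <= total_cost L N j X U)%E.
Proof. by move=> L0; apply: sume_ge0 => k _; exact: L0. Qed.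

(** The storage terms telescope. As they and [l] are real, the identity also
    holds when [J] is infinite. *)
Lemma mod_J_J lam (l : R) N j X U :
  mod_J P S lam l%:E N j X U =
  (J P S N j X U + (lam j X - lam (j + N)%N (traj S j X U N) - N%:R * l)%:E)%E.
Proof.
rewrite /mod_J /J; elim: N => [|N IH].
  by rewrite !big_ord0 addn0 /= mul0r subrr subr0 add0e.
rewrite !big_ord_recr /= IH /mod_ell addnS.
set A := (\sum_(_ < _) _)%E; set a := traj _ _ _ _ _; set b := next _ _ _ _.
rewrite -[in RHS]addeA -[in LHS]addeA; congr (_ + _)%E.
rewrite -!addeA addeCA; congr (_ + _)%E.
rewrite -!EFinN -!EFinD; congr (_%:E).
by rewrite -[N.+1]addn1 natrD; ring.
Qed.

End dynamic_programming.

Section noise.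
Context dd (Omega : measurableType dd) (R : realType) (P : probability Omega R)
  (Xsp Usp Wsp : completeNormedModType R) (S : ocp Omega Xsp Usp Wsp).

Lemma rv_next j (X : Omega -> Xsp) (U : Omega -> Usp) :
  separable Xsp -> separable Usp -> separable Wsp ->
  continuous (dyn S) -> rv (noise S j) -> rv X -> rv U -> rv (next S j X U).
Proof.
move=> /separable_open_base[bX bbX] /separable_open_base[bU bbU].
move=> /separable_open_base[bW bbW] cdyn mW mX mU.
apply: (rv_comp (X := fun w => (X w, U w, noise S j w)) cdyn).
apply: (@rv_pair _ _ (Xsp * Usp)%type Wsp _ _ (fun w => (X w, U w))
  (noise S j) (open_base_prod bbX bbU) bbW _ mW).
exact: (rv_pair bbX bbU mX mU).
Qed.

(** A control admissible from the successor state, preceded by [U], is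
    admissible from [X], and its trajectory visits the same states one step
    later; so the independence required from the successor state is part of
    the one required from [X]. *)
Lemma state_at_next j (X : Omega -> Xsp) (U : Omega -> Usp) :
  (rv X -> rv U -> rv (next S j X U)) ->
  state_at P S j X -> Uad S X U -> state_at P S j.+1 (next S j X U).
Proof.
move=> mnext [mX indX] UX; split; first by apply: mnext => //; case: UX.
move=> U' U'ad k.
have trajE i : traj S j X (splice (fun=> U) 1 U') i.+1 =
    traj S j.+1 (next S j X U) U' i.
  by rewrite -[i.+1]add1n traj_shift /= addn0 addn1 shift_splice.
have := indX (splice (fun=> U) 1 U') _ k.+1.
have spliceE i : splice (fun=> U) 1 U' i.+1 = U' i.
  by rewrite /splice /= subSS subn0.
rewrite trajE spliceE addnS -addSn; apply.
by case=> [//|i]; rewrite trajE spliceE; exact: U'ad.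
Qed.

End noise.

(** * Turnpike property and decrease of the modified optimal value *)

Section moduli.
Variable R : realType.

Lemma classK_le (a : R -> R) x y : classK a -> 0 <= x -> x <= y -> a x <= a y.
Proof.
move=> [_ ainc _] x0; rewrite le_eqVlt => /orP[/eqP->//|xy].
exact/ltW/ainc.
Qed.

Lemma classK_small (a : R -> R) e : classK a -> 0 < e ->
  exists2 s, 0 < s & a s <= e.
Proof.
move=> /classK_extension[f [cf _ f0] [fa _]] e0.
have /nbhs_ballP[s /= s0 sf] := cf 0 _ (nbhsx_ballx (f 0) e e0).
exists (s / 2); first by rewrite divr_gt0.
rewrite -fa ?divr_ge0//; last exact: ltW.
have : ball (f 0) e (f (s / 2)).
  by apply: sf; rewrite /ball/= sub0r normrN gtr0_norm ?divr_gt0//; lra.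
rewrite f0 /ball/= sub0r normrN => /ltW; apply: le_trans; exact: ler_norm.
Qed.

Lemma vanishing_small (g : R -> R -> R) e : vanishing g -> 0 < e ->
  exists n s, 0 < s /\
    forall (N : nat) r, (n < N)%N -> 0 <= r <= s -> g N%:R r <= e.
Proof.
move=> g0 e0; have /= := g0 _ (nbhsx_ballx (0 : R) e e0).
move=> [[A B] /= [[M [_ MA]] /nbhs_ballP[s /= s0 sB]] ABg].
exists (Num.truncn M).+1, (s / 2); split; first by rewrite divr_gt0.
move=> N r nN /andP[r0 rs].
have : ball 0 e (g N%:R r).
  apply: (ABg (N%:R, r)); split => /=.
    apply: MA; apply: lt_le_trans (truncnS_gt M) _.
    by rewrite ler_nat ltnW.
  by apply: sB => //=; rewrite /ball/= sub0r normrN ger0_norm//; lra.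
rewrite /ball/= sub0r normrN => /ltW; apply: le_trans; exact: ler_norm.
Qed.

Lemma er_map_le (a : R -> R) s x : classK a -> 0 <= s -> (s%:E <= x)%E ->
  ((a s)%:E <= er_map a x)%E.
Proof.
move=> aK s0; case: x => [x||].
- by rewrite !lee_fin => sx; exact: classK_le.
- by move=> _ /=; rewrite leey.
- by rewrite leeNy_eq.
Qed.

Lemma abse_sub_fin (x y : \bar R) (e : R) : (`|x - y| <= e%:E)%E ->
  exists x' y' : R, [/\ x = x'%:E, y = y'%:E & `|x' - y'| <= e].
Proof.
case: x => [x||]; case: y => [y||] //=.
by exists x, y; split => //; rewrite -lee_fin EFinN.
Qed.

End moduli.

Section dissipativity.
Context dd (Omega : measurableType dd) (R : realType) (P : probability Omega R)
  (Xsp Usp Wsp : completeNormedModType R) (S : ocp Omega Xsp Usp Wsp).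
Context (d : (Omega -> Xsp) -> (Omega -> Xsp) -> \bar R)
  (Xs : nat -> Omega -> Xsp) (Us : nat -> Omega -> Usp)
  (lam : nat -> (Omega -> Xsp) -> R) (l m : R) (alpha : R -> R).
Context
  (mnext : forall j X U, rv X -> rv U -> rv (next S j X U))
  (d_ge0 : forall X Y, rv X -> rv Y -> (0 <= d X Y)%E)
  (state_Xs : forall j, state_at P S j (Xs j))
  (lam_lb : forall j X, rv X -> m <= lam j X)
  (alphaK : classKoo alpha)
  (dissip : forall j X U, state_at P S j X -> Uad S X U ->
     (er_map alpha (d X (Xs j)) <= mod_ell P S lam l%:E j X U)%E).

Local Notation mod_ell := (mod_ell P S lam l%:E).
Local Notation mod_J := (mod_J P S lam l%:E).
Local Notation mod_V := (mod_V P S lam l%:E).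
Local Notation J := (J P S).
Local Notation V := (V P S).
Local Notation state_at := (state_at P S).
Local Notation traj := (traj S).
Implicit Types (j k N : nat) (X : Omega -> Xsp).

Lemma dist_ge0 j X : state_at j X -> (0 <= d X (Xs j))%E.
Proof. by move=> [mX _]; apply: d_ge0 => //; have [] := state_Xs j. Qed.

Lemma mod_ell_ge0 j X U : state_at j X -> Uad S X U -> (0 <= mod_ell j X U)%E.
Proof.
move=> sX UX; apply: le_trans (dissip sX UX).
have [aK _] := alphaK; have [_ _ a0] := aK.
by have := er_map_le aK (lexx 0) (dist_ge0 sX); rewrite a0.
Qed.

Lemma state_at_traj N j X U k : state_at j X -> UadN S N j X U ->
  (k <= N)%N -> state_at (j + k) (traj j X U k).
Proof.
move=> sX UN; elim: k => [|k IH] kN; first by rewrite addn0.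
rewrite addnS; apply: state_at_next; [exact: mnext|exact/IH/ltnW|exact: UN].
Qed.

Lemma mod_J_ge0 N j X U : state_at j X -> UadN S N j X U ->
  (0 <= mod_J N j X U)%E.
Proof.
move=> sX UN; apply: total_cost_ge0 => k kN; apply: mod_ell_ge0 (UN _ kN).
exact: state_at_traj (ltnW kN).
Qed.

Lemma mod_J_le N j X U k : state_at j X -> UadN S N j X U ->
  (k <= N)%N -> (mod_J k j X U <= mod_J N j X U)%E.
Proof.
move=> sX UN kN; have NE : N = (k + (N - k))%N by rewrite subnKC.
rewrite [in leRHS]NE.
apply: (@le_trans _ _ (mod_J k j X U +
    mod_J (N - k) (j + k) (traj j X U k) (shift U k))%E).
  rewrite leeDl//; apply: mod_J_ge0; first exact: state_at_traj UN kN.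
  by apply: UadN_shift; rewrite -NE.
by rewrite -[leRHS]/(total_cost S _ (k + _) j X U) total_cost_cat.
Qed.

Lemma mod_V_ge0 N j X : state_at j X -> (0 <= mod_V N j X)%E.
Proof. by move=> sX; apply/ereal_infP => _ [U UN <-]; exact: mod_J_ge0. Qed.

Lemma alpha_dist_le_mod_V N j X : (0 < N)%N -> state_at j X ->
  (er_map alpha (d X (Xs j)) <= mod_V N j X)%E.
Proof.
move=> N0 sX; apply/ereal_infP => _ [U UN <-].
apply: le_trans (mod_J_le sX UN N0).
rewrite /Defs.mod_J big_ord1 addn0; exact/dissip/(UN 0%N).
Qed.

Lemma mod_J_turnpike N j X U : state_at j X -> UadN S N j X U ->
  (\sum_(k < N) er_map alpha (d (traj j X U k) (Xs (j + k))) <=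
   mod_J N j X U)%E.
Proof.
move=> sX UN; apply: lee_sum => k _; apply: dissip; last exact: UN.
by apply: (state_at_traj sX UN); exact: ltnW.
Qed.

(** The turnpike property, for two controls simultaneously: each time in [1,
    ..., K] at which one of the two states is farther than [s] from the
    stationary state contributes at least [alpha s] to the sum of the two
    modified costs. Time 0 is excluded because a first step has to be split
    off in [mod_V_restart]. *)
Lemma common_turnpike N j X U1 U2 (C1 C2 s : R) K :
  state_at j X -> UadN S N j X U1 -> UadN S N j X U2 ->
  (mod_J N j X U1 <= C1%:E)%E -> (mod_J N j X U2 <= C2%:E)%E ->
  0 < s -> C1 + C2 < K%:R * alpha s -> (K < N)%N ->
  exists k, [/\ (k < K)%N,
    (d (traj j X U1 k.+1) (Xs (j + k.+1)) <= s%:E)%E &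
    (d (traj j X U2 k.+1) (Xs (j + k.+1)) <= s%:E)%E].
Proof.
move=> sX U1N U2N J1 J2 s0 CK KN.
have [aK _] := alphaK; have [_ _ a0] := aK.
apply: contrapT => /forallNP far.
have U1K := UadN_le KN U1N; have U2K := UadN_le KN U2N.
have a_ge0 U k : UadN S K.+1 j X U -> (k <= K)%N ->
    (0 <= er_map alpha (d (traj j X U k) (Xs (j + k))))%E.
  move=> UK kK; have sk := state_at_traj sX UK (leqW kK).
  by have := er_map_le aK (lexx 0) (dist_ge0 sk); rewrite a0.
suff : ((K%:R * alpha s)%:E <= mod_J K.+1 j X U1 + mod_J K.+1 j X U2)%E.
  move=> /le_trans/(_ (leeD (mod_J_le sX U1N KN) (mod_J_le sX U2N KN))).
  by move=> /le_trans/(_ (leeD J1 J2)); rewrite -EFinD lee_fin leNgt CK.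
apply: le_trans (leeD (mod_J_turnpike sX U1K) (mod_J_turnpike sX U2K)).
rewrite -big_split /= big_ord_recl /=.
apply: (@le_trans _ _ (\sum_(k < K) (alpha s)%:E)%E).
  by rewrite sumEFin sumr_const card_ord lee_fin mulr_natl.
rewrite -[leLHS]add0e; apply: leeD; first apply: adde_ge0.
- exact: (a_ge0 U1 0%N).
- exact: (a_ge0 U2 0%N).
apply: lee_sum => k _; rewrite /bump /= add1n.
have kK : (k.+1 <= K)%N by exact: ltn_ord.
have [d1|d1] := leP (d (traj j X U1 k.+1) (Xs (j + k.+1))) s%:E; last first.
  rewrite -[leLHS]adde0; apply: leeD; last exact: (a_ge0 U2 k.+1).
  by apply: er_map_le (ltW _) (ltW _).
have [d2|d2] := leP (d (traj j X U2 k.+1) (Xs (j + k.+1))) s%:E; last first.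
  rewrite -[leLHS]add0e; apply: leeD; first exact: (a_ge0 U1 k.+1).
  by apply: er_map_le (ltW _) (ltW _).
by have := far k; case; split.
Qed.

(** Nonnegativity of the modified cost bounds the original one from below, so an
    upper bound is enough for finiteness. *)
Lemma J_fin N j X U (C : R) : state_at j X -> UadN S N j X U ->
  (mod_J N j X U <= C%:E)%E -> exists a, J N j X U = a%:E.
Proof.
move=> sX UN; have := mod_J_ge0 sX UN; rewrite mod_J_J.
by case: (J N j X U) => [a _ _|//|//]; exists a.
Qed.

(** Up to a time [k] at which two admissible trajectories [U], [U2] from [X]
    are both close to the stationary state, an optimal [U] is cheaper than [U2]
    up to a small error: otherwise, since the optimal costs to go from the two
    close states nearly agree, following [U2] until [k] and then optimizing
    would beat [U]. This compares true costs; the optimality of [U] says nothing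
    about the modified costs directly. *)
Lemma optimal_head_le N j X U U2 k (e a a2 : R) : (k <= N)%N ->
  minimizer P S N j X U -> UadN S N j X U2 ->
  J k j X U = a%:E -> J k j X U2 = a2%:E ->
  (`|V (N - k) (j + k) (traj j X U k) - V (N - k) (j + k) (Xs (j + k))| <=
     e%:E)%E ->
  (`|V (N - k) (j + k) (traj j X U2 k) - V (N - k) (j + k) (Xs (j + k))| <=
     e%:E)%E ->
  a <= a2 + 2 * e.
Proof.
move=> kN [UN JV] U2N aE a2E.
move=> /abse_sub_fin[p1 [p [p1E pE p1p]]] /abse_sub_fin[p2 [p' [p2E p'E p2p]]].
have pp' : p = p' by apply: EFin_inj; rewrite -pE -p'E.
rewrite -{}pp' in p2p.
have NE : N = (k + (N - k))%N by rewrite subnKC.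
have : a + p1 <= a2 + p2.
  rewrite -lee_fin !EFinD -p1E -p2E -aE -a2E.
  apply: (@le_trans _ _ (V N j X)).
    have JN : J N j X U =
        (J k j X U + J (N - k) (j + k) (traj j X U k) (shift U k))%E.
      by rewrite [in LHS]NE; exact: (total_cost_cat S (fun=> ell P S)).
    rewrite -JV JN leeD2l//; apply: (optimal_value_le (fun=> ell P S)).
    by apply: UadN_shift; rewrite -NE.
  rewrite [in leLHS]NE.
  apply: (optimal_value_cat_le (L := fun=> ell P S)).
    exact: UadN_le kN U2N.
  by rewrite -[total_cost _ _ _ _ _ _]/(J k j X U2) a2E.
by move: p1p p2p; rewrite !ler_norml => /andP[? ?] /andP[? ?]; lra.
Qed.

(** Dropping the first step of [U] and continuing after time [k.+1] by a nearly
    optimal control of the modified problem gives a candidate from the successor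
    state; splitting the first stage off [mod_J k.+1] makes the modified stage
    cost appear. *)
Lemma mod_V_restart j X U k m' (c e : R) : state_at j X ->
  UadN S k.+1 j X U -> mod_J k.+1 j X U = c%:E ->
  (mod_V m' (j + k.+1) (traj j X U k.+1) <= e%:E)%E ->
  (mod_V (k + m') j.+1 (next S j X (U 0%N)) + mod_ell j X (U 0%N) <=
   (c + e)%:E)%E.
Proof.
move=> sX Uk cE Ve; have tr1 : traj j X U 1 = next S j X (U 0%N).
  by rewrite /= addn0.
have s1 : state_at j.+1 (next S j X (U 0%N)).
  by have := state_at_traj sX Uk (ltn0Sn k); rewrite addn1 tr1.
have U1k : UadN S k j.+1 (next S j X (U 0%N)) (shift U 1).
  by have := UadN_shift (k := 1) Uk; rewrite addn1 tr1.
have : mod_J k.+1 j X U =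
    (mod_ell j X (U 0%N) + mod_J k j.+1 (next S j X (U 0%N)) (shift U 1))%E.
  rewrite -[LHS]/(total_cost S _ (1 + k) j X U) total_cost_cat addn1 tr1.
  by congr (_ + _)%E; rewrite /total_cost big_ord1 addn0.
have := mod_ell_ge0 sX (Uk 0%N (ltn0Sn k)); have := mod_J_ge0 s1 U1k.
rewrite cE; case qE : (mod_ell j X (U 0%N)) => [q||];
  case tE : (mod_J k j.+1 _ _) => [t||] // _ _ [->].
have tr : traj j.+1 (next S j X (U 0%N)) (shift U 1) k = traj j X U k.+1.
  by rewrite -[k.+1 in RHS]add1n traj_shift addn1 tr1.
have -> : (q + t + e)%:E = (t%:E + e%:E + q%:E)%E.
  by rewrite -!EFinD; congr _%:E; ring.
rewrite leeD2r// -tE.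
apply: le_trans (optimal_value_cat_le (L := mod_ell) m' U1k _) _.
  by rewrite -[total_cost _ _ _ _ _ _]/(mod_J k _ _ _) tE.
by rewrite leeD2l// tr addSnnS.
Qed.

(** The optimal value of the modified problem decreases along one step of an
    optimal control [U] of the original problem. By the turnpike property, [U]
    and a nearly optimal control [U2] of the modified problem are close to the
    stationary state at a common time [k.+1]. Until then their modified costs
    nearly agree, as the storage functions at the two end points cancel up to
    an error, and from then on the modified cost to go is negligible.
    The error [6 * e] counts: 1 for [U2], 2 for [optimal_head_le], 1 for each of
    the two storage functions, 1 for the remaining cost. *)
Lemma nearly_decreasing (e s C1 C2 : R) M K N j X U :
  0 < e -> 0 < s ->
  (forall N j X, (M < N)%N -> cball P S d Xs s j X ->
    [/\ (`|V N j X - V N j (Xs j)| <= e%:E)%E,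
        `|lam j X - lam j (Xs j)| <= e & (mod_V N j X <= e%:E)%E]) ->
  state_at j X -> minimizer P S N j X U ->
  (mod_J N j X U <= C1%:E)%E -> (mod_V N j X + e%:E <= C2%:E)%E ->
  C1 + C2 < K%:R * alpha s -> (K + M < N)%N ->
  (mod_V N j.+1 (next S j X (U 0%N)) + mod_ell j X (U 0%N) <=
   mod_V N j X + (6 * e)%:E)%E.
Proof.
move=> e0 s0 loc sX minU JC1 VC2 CK KMN; have [UN _] := minU.
have KN : (K < N)%N by exact: leq_ltn_trans (leq_addr _ _) KMN.
have Vfin : mod_V N j X \is a fin_num.
  by have := mod_V_ge0 N sX; move: VC2; case: (mod_V N j X).
have [_ [U2 U2N <-]] := lb_ereal_inf_adherent e0 Vfin.
rewrite -/(mod_V N j X) => J2V.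
have J2C : (mod_J N j X U2 <= C2%:E)%E by exact: le_trans (ltW J2V) VC2.
have [k [kK d1 d2]] := common_turnpike sX UN U2N JC1 J2C s0 CK KN.
have kN : (k < N)%N by exact: leq_trans kK (ltnW KN).
have MNk : (M < N - k.+1)%N.
  by rewrite ltn_subRL; apply: leq_ltn_trans KMN; rewrite leq_add2r.
have s1 := state_at_traj sX UN kN; have s2 := state_at_traj sX U2N kN.
have [V1 lam1 _] := loc _ _ _ MNk (conj s1 d1).
have [V2 lam2 _] := loc _ _ _ MNk (conj s2 d2).
have Uk := UadN_le kN UN; have U2k := UadN_le kN U2N.
have J1k := mod_J_le sX UN kN; have J2k := mod_J_le sX U2N kN.
have [a1 a1E] := J_fin sX Uk (le_trans J1k JC1).
have [a2 a2E] := J_fin sX U2k (le_trans J2k J2C).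
have a12 := optimal_head_le kN minU U2N a1E a2E V1 V2.
have J1kE := mod_J_J P S lam l k.+1 j X U; rewrite a1E -EFinD in J1kE.
have MNk' : (M < N - k)%N by apply: leq_trans MNk _; rewrite leq_sub2l.
have [_ _ V3] := loc _ _ _ MNk' (conj s1 d1).
have := mod_V_restart sX Uk J1kE V3; rewrite subnKC 1?ltnW//.
move=> /le_trans; apply.
move: (le_lt_trans J2k J2V); rewrite mod_J_J a2E -(fineK Vfin) -!EFinD.
rewrite lte_fin lee_fin => a2v.
by move: lam1 lam2; rewrite !ler_norml => /andP[? ?] /andP[? ?]; lra.
Qed.

Section stationary_process.
Context (Us_ad : forall k, Uad S (Xs k) (Us k))
  (Xs_next : forall k, Xs k.+1 = next S k (Xs k) (Us k))
  (mod_ell_stat : forall j, mod_ell j (Xs j) (Us j) = 0%E).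

Lemma traj_Xs j k : traj j (Xs j) (shift Us j) k = Xs (j + k).
Proof.
elim: k => [|k IH]; first by rewrite addn0.
by rewrite /= IH /shift -Xs_next addnS.
Qed.

(** The stationary control has modified cost 0, the least possible value. *)
Lemma mod_V_Xs N j : mod_V N j (Xs j) = 0%E.
Proof.
apply/eqP; rewrite eq_le mod_V_ge0// andbT.
have ad : UadN S N j (Xs j) (shift Us j) by move=> k _; rewrite traj_Xs.
apply: le_trans (optimal_value_le mod_ell ad) _.
rewrite /total_cost big1// => k _; rewrite traj_Xs; exact: mod_ell_stat.
Qed.

Context
  (cheap : forall r : R, 0 < r -> exists C : R, forall N j X, (0 < N)%N ->
     cball P S d Xs r j X -> (V N j X - (N%:R * l)%:E <= C%:E)%E)
  (lam_bounded : forall r : R, 0 < r -> bounded_on_cball P S d Xs lam r)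
  (V_cont : exists (eps : R) (gV : R -> R -> R),
    [/\ 0 < eps, vanishing gV &
        forall (N j : nat) X, (0 < N)%N -> cball P S d Xs eps j X ->
          (`|V N j X - V N j (Xs j)| <= er_map (gV N%:R) (d X (Xs j)))%E])
  (mod_V_cont : forall r : R, 0 < r ->
    exists (eps : R) (glam gmod : R -> R),
    [/\ 0 < eps <= r, classKoo glam, classKoo gmod,
        forall (j : nat) X, cball P S d Xs eps j X ->
          (`|(lam j X - lam j (Xs j))%:E| <= er_map glam (d X (Xs j)))%E &
        forall (N j : nat) X, (0 < N)%N -> cball P S d Xs r j X ->
          (`|mod_V N j X - mod_V N j (Xs j)| <=
           er_map gmod (d X (Xs j)))%E]).

Lemma cball_dist r j X : cball P S d Xs r j X ->
  exists2 x, d X (Xs j) = x%:E & 0 <= x <= r.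
Proof.
move=> [sX]; have := dist_ge0 sX; case: (d X (Xs j)) => [x||//]//.
by rewrite !lee_fin => x0 xr; exists x => //; rewrite x0.
Qed.

Lemma mod_V_le (g : R -> R) N j X x : d X (Xs j) = x%:E ->
  (`|mod_V N j X - mod_V N j (Xs j)| <= er_map g (d X (Xs j)))%E ->
  (mod_V N j X <= (g x)%:E)%E.
Proof.
move=> -> ; rewrite mod_V_Xs sube0; apply: le_trans; exact: lee_abs.
Qed.

(** The continuity moduli come one for each ball; gluing them gives a single
    upper bound, so that the final bound of class KL is the same for all
    initial radii. *)
Lemma mod_V_majorant : exists2 g, globalK g &
  forall N j X x, (0 < N)%N -> state_at j X -> d X (Xs j) = x%:E ->
    (mod_V N j X <= (g x)%:E)%E.
Proof.
have cE n : exists c : R -> R, classK c /\ forall N j X x, (0 < N)%N ->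
    state_at j X -> d X (Xs j) = x%:E -> x <= n.+1%:R ->
    (mod_V N j X <= (c x)%:E)%E.
  have [_ [_ [c [_ _ [cK _] _ cV]]]] := mod_V_cont (ltr0Sn R n).
  exists c; split=> // N j X x N0 sX dx xn; apply: mod_V_le (dx) _.
  by apply: cV => //; split => //; rewrite dx lee_fin.
have [c cP] := choice cE.
have [g gK gc] := classK_majorant (fun n => (cP n).1).
exists g => // N j X x N0 sX dx.
have x0 : 0 <= x by have := dist_ge0 sX; rewrite dx lee_fin.
have [n xn cg] := gc x x0.
by apply: le_trans ((cP n).2 _ _ _ _ N0 sX dx xn) _; rewrite lee_fin.
Qed.

Lemma locally_close e : 0 < e -> exists s M, 0 < s /\
  forall N j X, (M < N)%N -> cball P S d Xs s j X ->
    [/\ (`|V N j X - V N j (Xs j)| <= e%:E)%E,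
        `|lam j X - lam j (Xs j)| <= e & (mod_V N j X <= e%:E)%E].
Proof.
move=> e0.
have [epsV [gV [epsV0 gV0 gVP]]] := V_cont.
have [eps [gl [gm [/andP[eps0 eps1] [glK _] [gmK _] glP gmP]]]] :=
  mod_V_cont ltr01.
have [M [sV [sV0 sVP]]] := vanishing_small gV0 e0.
have [sl sl0 slP] := classK_small glK e0.
have [sm sm0 smP] := classK_small gmK e0.
pose s := Num.min (Num.min epsV eps) (Num.min sV (Num.min sl sm)).
have : s <= s by [].
rewrite {2}/s !le_min => /andP[/andP[s1 s2] /and3P[s3 s4 s5]].
have s0 : 0 < s by rewrite /s !lt_min epsV0 eps0 sV0 sl0 sm0.
exists s, M; split => // N j X MN Xs_s.
have [x dx /andP[x0 xs]] := cball_dist Xs_s; have [sX _] := Xs_s.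
have N0 : (0 < N)%N by exact: leq_ltn_trans MN.
have inball r : s <= r -> cball P S d Xs r j X.
  by move=> sr; split=> //; rewrite dx lee_fin (le_trans xs).
split.
- apply: le_trans (gVP N j X N0 (inball _ s1)) _; rewrite dx lee_fin.
  by apply: sVP => //; rewrite x0 (le_trans xs).
- have := glP j X (inball _ s2); rewrite dx lee_fin => /le_trans; apply.
  by apply: le_trans slP; apply: classK_le; rewrite ?(le_trans xs).
- have := mod_V_le dx (gmP N j X N0 (inball _ (le_trans s2 eps1))).
  move=> /le_trans; apply; rewrite lee_fin; apply: le_trans smP.
  by apply: classK_le; rewrite ?(le_trans xs).
Qed.

Lemma lyapunov_decrease r del : 0 < r -> 0 < del -> exists N0,
  forall N j X U, (N0 <= N)%N -> cball P S d Xs r j X ->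
    minimizer P S N j X U ->
    (mod_V N j.+1 (next S j X (U 0%N)) + mod_ell j X (U 0%N) <=
     mod_V N j X + del%:E)%E.
Proof.
move=> r0 del0; pose e := del / 6.
have e0 : 0 < e by rewrite divr_gt0.
have [s [M [s0 loc]]] := locally_close e0.
have [CV CVP] := cheap r0; have [Cl ClP] := lam_bounded r0.
have [g gK gP] := mod_V_majorant.
have [aK _] := alphaK; have [_ ainc a0] := aK.
have as0 : 0 < alpha s by rewrite -[ltLHS]a0 ainc.
(* C1 bounds the modified cost of optimal controls, by cheap reachability
   and the bounds on the storage function; C2 that of nearly optimal
   modified ones. *)
pose C1 := CV + Cl - m; pose C2 := g r + e.
pose K := (Num.truncn ((C1 + C2) / alpha s)).+1.
have CK : C1 + C2 < K%:R * alpha s.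
  by rewrite -ltr_pdivrMr//; exact: truncnS_gt.
exists (K + M).+1 => N j X U KMN Xr UN; have [sX _] := Xr.
have N0 : (0 < N)%N by exact: leq_ltn_trans KMN.
have [x dx /andP[x0 xr]] := cball_dist Xr.
have -> : del = 6 * e by rewrite /e; field.
apply: (nearly_decreasing e0 s0 loc sX UN _ _ CK KMN).
  have [UadN_U JV] := UN; rewrite mod_J_J JV.
  have mX : m <= lam (j + N)%N (traj j X U N).
    by apply: lam_lb; have [] := state_at_traj sX UadN_U (leqnn N).
  have := ClP j X Xr; rewrite ler_norml => /andP[_ lamC].
  have := CVP N j X N0 Xr.
  rewrite /C1; case: (V N j X) => [v||] /=.
  - by rewrite -!EFinD !lee_fin; lra.
  - by rewrite leye_eq.
  - by move=> _; rewrite addNye leNye.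
rewrite /C2 EFinD leeD2r//; apply: le_trans (gP _ _ _ _ N0 sX dx) _.
by rewrite lee_fin; have [_ ginc _] := gK; exact: ltW_homo.
Qed.

End stationary_process.

End dissipativity.

(** * Practical stability of real sequences *)

Section practical_stability.
Variable R : realType.

Lemma globalK_le (f : R -> R) : globalK f -> {homo f : x y / x <= y}.
Proof. by move=> [_ finc _]; exact: ltW_homo. Qed.

Lemma globalK_classK (f : R -> R) : globalK f -> classK f.
Proof.
move=> [cf finc f0]; split=> //; first exact: continuous_subspaceT.
by move=> x y _; exact: finc.
Qed.

Lemma globalK_double (g : R -> R) : globalK g -> globalK (fun s => g s + g s).
Proof.
move=> [cg ginc g0]; split; last by rewrite g0 addr0.
  by move=> x; apply: cvgD; exact: cg.
by move=> x y xy; rewrite ltrD// ginc.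
Qed.

(** Close to the stationary process ([x <= s]) the value [v] is at most half of
    the threshold and cannot exceed it after an increase by [del]; farther away
    half of [a x] absorbs [del]. *)
Lemma practical_step (a g : R -> R) (s th del x v v' : R) :
  classK a -> globalK g -> 0 < s -> 0 <= x ->
  g s <= th / 2 -> del <= th / 2 -> 2 * del <= a s ->
  a x <= v <= g x -> v' + a x <= v + del ->
  (v <= th -> v' <= th) /\ (th < v -> v' + a x / 2 <= v).
Proof.
move=> aK gK s0 x0 gs delth dels /andP[av vg] vv'.
have ax0 : 0 <= a x by have [_ _ <-] := aK; exact: classK_le.
have [xs|sx] := leP x s.
  by have := globalK_le gK xs; split; lra.
by have := classK_le aK (ltW s0) (ltW sx); split; lra.
Qed.

(** As the value never exceeds [th] again once it is below, [th < v k] means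
    that it was above [th] all the time and decreased in each step by at least
    half of [a (x i)]. So the average of the [a (x i)], [i <= k], is at most
    [2 * v 0 / (1 + k)]; take an [i] where [a (x i)] is at most this average and
    use [v k <= v i] to pass from [x i] to [x k]. *)
Lemma practical_decay (a g b : R -> R) (s th del : R) (x v : nat -> R) k :
  classK a -> globalK g -> globalK b ->
  (forall x y, 0 <= x -> a x <= y -> x <= b y) ->
  0 < s -> g s <= th / 2 -> del <= th / 2 -> 2 * del <= a s ->
  (forall i, (i <= k)%N -> 0 <= x i /\ a (x i) <= v i <= g (x i)) ->
  (forall i, (i < k)%N -> v i.+1 + a (x i) <= v i + del) ->
  th < v k ->
  x k <= b (g (b ((g (x 0%N) + g (x 0%N)) / (1 + k%:R)))).
Proof.
move=> aK gK bK ab s0 gs delth dels sand dec vk.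
have step i (ik : (i < k)%N) :=
  practical_step aK gK s0 (sand i (ltnW ik)).1 gs delth dels
    (sand i (ltnW ik)).2 (dec i ik).
have th_lt n : (n <= k)%N -> th < v (k - n)%N.
  elim: n => [|n IH] nk; first by rewrite subn0.
  have kn : (k - n.+1 < k)%N by rewrite ltn_subrL/=; exact: leq_trans nk.
  rewrite ltNge; apply/negP => /(step _ kn).1.
  by rewrite -subSn// subSS leNgt IH// ltnW.
have th_lt' i : (i <= k)%N -> th < v i.
  by move=> ik; rewrite -(subKn ik) th_lt// leq_subr.
have dec2 i (ik : (i < k)%N) : v i.+1 + a (x i) / 2 <= v i.
  by apply: (step i ik).2; exact/th_lt'/ltnW.
set c := (_ / _).
have kS0 : (0 : R) < 1 + k%:R by rewrite addrC natr1.
have [i [ik aic]] : exists i, (i <= k)%N /\ a (x i) <= c.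
  apply: contrapT => /forallNP large.
  have a_gt i : (i <= k)%N -> c < a (x i).
    by move=> ik; rewrite ltNge; apply/negP => ?; exact: (large i).
  have sum_le n : (n <= k)%N -> v n + n%:R * (c / 2) <= v 0%N.
    elim: n => [|n IH] nk; first by rewrite mul0r addr0.
    have := IH (ltnW nk); have := dec2 n nk; have := a_gt n (ltnW nk).
    by rewrite -[n.+1%:R]natr1; lra.
  have [_ /andP[avk _]] := sand k (leqnn k).
  have [_ /andP[_ vg0]] := sand 0%N (leq0n k).
  have := sum_le k (leqnn k); have := a_gt k (leqnn k).
  have cE : c * (1 + k%:R) = g (x 0%N) + g (x 0%N) by rewrite /c divfK// gt_eqF.
  have c0 : 0 <= c.
    have [x00 _] := sand 0%N (leq0n k).
    by rewrite /c divr_ge0// ?(ltW kS0)// addr_ge0// globalK_ge0.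
  by nra.
have vki : v k <= v i.
  have mono n : (i + n <= k)%N -> v (i + n)%N <= v i.
    elim: n => [|n IH]; rewrite ?addn0// addnS => ink.
    have := IH (ltnW ink); have := dec2 _ ink.
    have [x0 _] := sand _ (ltnW ink).
    have [_ _ a0] := aK; have := classK_le aK (lexx 0) x0; rewrite a0.
    by lra.
  by rewrite -[in leLHS](subnKC ik) mono// subnKC.
have [xi0 /andP[_ vig]] := sand i ik.
have [xk0 /andP[avk _]] := sand k (leqnn k).
apply: (ab) => //; apply: (le_trans avk); apply: (le_trans vki).
by apply: (le_trans vig); apply: globalK_le => //; exact: ab.
Qed.

End practical_stability.

(** * Stability of the closed loop *)

Theorem corollary5p16
  (disp : measure_display) (Omega : measurableType disp) (R : realType)
  (P : probability Omega R)
  (Xsp Usp Wsp : completeNormedModType R)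
  (sepX : separable Xsp) (sepU : separable Usp) (sepW : separable Wsp)
  (S : ocp Omega Xsp Usp Wsp)
  (dyn_cont : continuous (dyn S))
  (PW : probability (borelType Wsp) R)
  (noise_iid : iid P (noise S) PW)
  (cost_lsc : lower_semicontinuous (fun z => (stage_cost S z)%:E))
  (cost_bounded_below : exists m : R, forall z, m <= stage_cost S z)
  (* MPC feedback; the first argument is the optimization horizon *)
  (mu : nat -> nat -> (Omega -> Xsp) -> (Omega -> Usp))
  (mu_mpc : mpc_feedback P S mu)
  (d : (Omega -> Xsp) -> (Omega -> Xsp) -> \bar R)
  (d_pseudometric : pseudometric d)
  (Xs : nat -> Omega -> Xsp) (Us : nat -> Omega -> Usp)
  (stat : stationary_pair P S Xs Us)
  (stat_fin : stationary_cost P S Xs Us \is a fin_num)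
  (lam : nat -> (Omega -> Xsp) -> R) (alpha : R -> R)
  (* (1) *)
  (dissip : strictly_dissipative P S d Xs Us lam alpha)
  (* (2) *)
  (lam_bounded : forall r : R, 0 < r -> bounded_on_cball P S d Xs lam r)
  (cheap : forall r : R, 0 < r -> cheaply_reachable P S d Xs Us r)
  (* (3) *)
  (V_cont : exists (eps : R) (gV : R -> R -> R),
    [/\ 0 < eps,
        forall n r, 0 <= n -> 0 <= r -> 0 <= gV n r,
        vanishing gV,
        (forall r, 0 <= r -> monotone_nonneg (gV ^~ r)) /\
        (forall n, 0 <= n -> monotone_nonneg (gV n)) &
        forall (N j : nat) X, (0 < N)%N -> cball P S d Xs eps j X ->
          (`|V P S N j X - V P S N j (Xs j)| <=
           er_map (gV N%:R) (d X (Xs j)))%E])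
  (* (4) *)
  (mod_ell_stat : forall j : nat,
    mod_ell P S lam (stationary_cost P S Xs Us) j (Xs j) (Us j) = 0%E)
  (* (5) *)
  (mod_V_cont : forall r : R, 0 < r ->
    exists (eps : R) (glam gmod : R -> R),
    [/\ 0 < eps <= r, classKoo glam, classKoo gmod,
        forall (j : nat) X, cball P S d Xs eps j X ->
          (`|(lam j X - lam j (Xs j))%:E| <= er_map glam (d X (Xs j)))%E &
        forall (N j : nat) X, (0 < N)%N -> cball P S d Xs r j X ->
          (`|mod_V P S lam (stationary_cost P S Xs Us) N j X -
             mod_V P S lam (stationary_cost P S Xs Us) N j (Xs j)| <=
           er_map gmod (d X (Xs j)))%E]) :
  exists2 beta : R -> R -> R, classKL beta &
    forall D1 D2 : R, 0 < D1 -> D1 < D2 ->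
    exists2 ND : nat, (0 < ND)%N &
      forall (N j0 j : nat) X, (ND <= N)%N -> cball P S d Xs D2 j0 X ->
        (* the minimizers defining the closed loop up to time j exist *)
        (forall i, (i < j)%N -> exists U,
           minimizer P S N (j0 + i) (closed_loop S (mu N) j0 X i) U) ->
        (d (closed_loop S (mu N) j0 X j) (Xs (j + j0)%N) <=
         maxe (er_map (beta ^~ j%:R) (d X (Xs j0))) D1%:E)%E.
Proof.
have mnext j X U : rv X -> rv U -> rv (next S j X U).
  by have [mW _ _] := noise_iid; exact: rv_next.
have [d_ge0 _ _ _] := d_pseudometric.
have [state0 Xs_next Us_adm _] := stat.
have traj_Xs0 k : traj S 0 (Xs 0%N) Us k = Xs k.
  by elim: k => [//|k IH]; rewrite /= IH add0n -Xs_next.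
have Us_ad k : Uad S (Xs k) (Us k) by rewrite -traj_Xs0; exact: Us_adm.
have state_Xs j : state_at P S j (Xs j).
  elim: j => [//|j IH]; rewrite Xs_next.
  exact: state_at_next (mnext _ _ _) IH (Us_ad j).
pose l := fine (stationary_cost P S Xs Us).
have lE : stationary_cost P S Xs Us = l%:E by rewrite /l fineK.
have [[m lam_lb] alphaK dis] := dissip.
rewrite lE in mod_ell_stat mod_V_cont dis.
have cheap' r : 0 < r -> exists C : R, forall N j X, (0 < N)%N ->
    cball P S d Xs r j X -> (V P S N j X - (N%:R * l)%:E <= C%:E)%E.
  move=> /cheap[C _ CP]; exists C => N j X N0 Xr.
  by have := CP N j X N0 Xr; rewrite lE.
have V_cont' : exists (eps : R) (gV : R -> R -> R),
    [/\ 0 < eps, vanishing gV &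
        forall (N j : nat) X, (0 < N)%N -> cball P S d Xs eps j X ->
          (`|V P S N j X - V P S N j (Xs j)| <=
           er_map (gV N%:R) (d X (Xs j)))%E].
  by have [eps [gV [e0 _ gV0 _ gVP]]] := V_cont; exists eps, gV; split.
have [b bK ab] := classKoo_inverse alphaK.
have [g gK gP] := mod_V_majorant mnext d_ge0 state_Xs alphaK dis Us_ad Xs_next
  mod_ell_stat mod_V_cont.
have [aK a_unb] := alphaK; have [_ a_inc a0] := aK.
exists (fun s t => b (g (b ((g s + g s) / (1 + t))))).
  apply: (classKL_harmonic (F := b \o g \o b)); last exact: globalK_double.
  exact/globalK_comp/bK/globalK_comp.
move=> D1 D2 D10 D12.
(* A distance above D1 forces the Lyapunov function above th, so the bound only
   has to be shown there. *)
pose th := alpha D1.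
have th0 : 0 < th by rewrite /th -a0 a_inc.
have [s s0 gs] : exists2 s, 0 < s & g s <= th / 2.
  by apply: classK_small; [exact: globalK_classK|rewrite divr_gt0].
have as0 : 0 < alpha s by rewrite -a0 a_inc.
pose del := Num.min (th / 2) (alpha s / 2).
have del0 : 0 < del by rewrite /del lt_min !divr_gt0.
have [delth dels] : del <= th / 2 /\ 2 * del <= alpha s.
  have : del <= del by []; rewrite {2}/del le_min => /andP[? ?].
  by split=> //; lra.
(* The sublevel set of L is invariant and contains the ball of radius D2; it
   lies in the ball of radius r, on which the decrease is uniform. *)
pose L := g D2 + th.
have gD2 : 0 <= g D2 by apply: globalK_ge0 => //; lra.
have L0 : 0 < L by rewrite ltr_wpDl.
have [r r_ge0 Lr] := a_unb L.
have r0 : 0 < r.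
  move: r_ge0; rewrite le_eqVlt => /orP[/eqP rE|//].
  by move: Lr; rewrite -rE a0; lra.
have [N0 decr] := lyapunov_decrease mnext d_ge0 state_Xs lam_lb alphaK dis
  Us_ad Xs_next mod_ell_stat cheap' lam_bounded V_cont' mod_V_cont r0 del0.
exists N0.+1 => // N j0 j X N0N [sX XD2] minU.
have N_gt0 : (0 < N)%N by exact: leq_ltn_trans N0N.
have level i Y : state_at P S i Y -> (mod_V P S lam l%:E N i Y <= L%:E)%E ->
    exists x v, [/\ d Y (Xs i) = x%:E, mod_V P S lam l%:E N i Y = v%:E,
      0 <= x <= r, alpha x <= v <= g x & v <= L].
  move=> sY.
  have := alpha_dist_le_mod_V mnext d_ge0 state_Xs alphaK dis N_gt0 sY.
  have := dist_ge0 d_ge0 state_Xs sY; have := gP N i Y _ N_gt0 sY.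
  have := mod_V_ge0 mnext d_ge0 state_Xs alphaK dis N sY.
  case: (mod_V _ _ _ _ _ _ _) => [v||//]; case: (d Y (Xs i)) => [x||//] //=.
  move=> v0 /(_ x erefl); rewrite !lee_fin => vg x0 av vL.
  exists x, v; split=> //; last by rewrite av.
  by rewrite x0 leNgt; apply/negP => /(a_inc _ _ r_ge0); lra.
pose Y i := closed_loop S (mu N) j0 X i.
pose W i := mod_V P S lam l%:E N (j0 + i) (Y i).
have one_step i : (i < j)%N -> state_at P S (j0 + i) (Y i) ->
    (W i <= L%:E)%E ->
    state_at P S (j0 + i.+1) (Y i.+1) /\
    (W i.+1 + er_map alpha (d (Y i) (Xs (j0 + i)%N)) <= W i + del%:E)%E.
  move=> ij sY WL; have [U UN muE] := mu_mpc _ _ _ N_gt0 sY (minU i ij).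
  have Y'E : Y i.+1 = next S (j0 + i) (Y i) (U 0%N) by rewrite /Y /= muE.
  have UY : Uad S (Y i) (U 0%N) by have [/(_ 0%N N_gt0)] := UN.
  split; first by rewrite Y'E addnS; exact: state_at_next (mnext _ _ _) sY UY.
  have [x [v [dx _ /andP[_ xr] _ _]]] := level _ _ sY WL.
  have Yr : cball P S d Xs r (j0 + i) (Y i) by split=> //; rewrite dx lee_fin.
  rewrite /W Y'E addnS.
  apply: le_trans (decr N (j0 + i)%N (Y i) U (ltnW N0N) Yr UN).
  by rewrite leeD2l// dis.
have invariant i : (i <= j)%N -> state_at P S (j0 + i) (Y i) /\ (W i <= L%:E)%E.
  elim: i => [_|i IH ij].
    rewrite /W /Y /= addn0; split=> //.
    have := dist_ge0 d_ge0 state_Xs sX; move: XD2; have := gP N j0 X _ N_gt0 sX.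
    case: (d X (Xs j0)) => [x||//] //= /(_ x erefl) Vg.
    rewrite !lee_fin => xD2 x0; apply: (le_trans Vg); rewrite lee_fin.
    by have := globalK_le gK xD2; rewrite /L; lra.
  have [sY WL] := IH (ltnW ij); have [sY' dec] := one_step i ij sY WL.
  split=> //.
  have [x [v [dx vE /andP[x0 xr] avg vL]]] := level _ _ sY WL.
  move: dec; rewrite dx /= {2}/W vE.
  have := mod_V_ge0 mnext d_ge0 state_Xs alphaK dis N sY'.
  rewrite -/(W i.+1); case: (W i.+1) => [v'||//] //= _.
  rewrite -!EFinD !lee_fin => dec.
  have [keep drop] := practical_step aK gK s0 x0 gs delth dels avg dec.
  have ax0 : 0 <= alpha x by rewrite -a0; exact: classK_le.
  have [/keep|/drop] := leP v th; last by lra.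
  by rewrite /L; lra.
pose x i := fine (d (Y i) (Xs (j0 + i)%N)); pose v i := fine (W i).
have xvP i : (i <= j)%N -> [/\ d (Y i) (Xs (j0 + i)%N) = (x i)%:E,
    W i = (v i)%:E, 0 <= x i & alpha (x i) <= v i <= g (x i)].
  move=> /invariant[sY WL].
  have [x' [v' [dx vE /andP[x0 _] avg _]]] := level _ _ sY WL.
  by rewrite /x /v /W dx vE.
have [dj Wj xj0 /andP[avj _]] := xvP j (leqnn j).
have [dj0 _ _ _] := xvP 0%N (leq0n j).
move: dj0; rewrite addn0 /Y /= => ->.
rewrite addnC -/(Y j) dj le_max /= !lee_fin.
have [xD1|D1x] := leP (x j) D1; first by rewrite orbT.
apply/orP; left; apply: (practical_decay (v := v) aK gK bK ab s0 gs delth dels).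
- by move=> i ij; have [] := xvP i ij.
- move=> i ij; have [di Wi _ _] := xvP i (ltnW ij).
  have [_ Wi' _ _] := xvP i.+1 ij.
  have [sY WL] := invariant i (ltnW ij); have [_] := one_step i ij sY WL.
  by rewrite di Wi Wi' -!EFinD lee_fin.
- by apply: lt_le_trans avj; apply: a_inc => //; exact: ltW.
Qed.
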